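(* Let $k\ge1$ be an integer. For $\mu$-almost all $\alpha\in\mathbb{Q}_p$ there exist infinitely many $i\in\mathbb{N}$ such that $v_p(a_{2i+1})\le -k$, where $a_i$ is the $i$-th partial quotient of the continued fraction of $\alpha$ produced by the alternating $s$/$t$ algorithm.
   Context: $p$ is an odd prime, $v_p$ the $p$-adic valuation, $\mu$ the Haar measure on $\mathbb{Q}_p$ normalized by $\mu(p\mathbb{Z}_p)=1$. For $\alpha=\sum_{n\ge -r}c_np^n\in\mathbb{Q}_p$ with $c_n\in\{-\frac{p-1}2,\dots,\frac{p-1}2\}$, put $s(\alpha)=\sum_{n=-r}^{0}c_np^n$ (equal to $0$ if $r<0$) and $t(\alpha)=\sum_{n=-r}^{-1}c_np^n$ (equal to $0$ if $r\le0$). The alternating $s$/$t$ algorithm computes, from $\alpha_0=\alpha$, for $n\ge0$: $a_n=s(\alpha_n)$ if $n$ is even, $a_n=t(\alpha_n)$ if $n$ is odd, and $\alpha_{n+1}=\frac1{\alpha_n-a_n}$, stopping if $\alpha_n=a_n$. *)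

(* Defs.v *)
From HB Require Import structures.
From mathcomp Require Import all_boot all_order all_algebra.
From mathcomp Require Import all_classical all_reals all_analysis.
From mathcomp Require Import fraction generic_quotient.
From mathcomp Require Import zify ring.

Set Implicit Arguments.
Unset Strict Implicit.
Unset Printing Implicit Defensive.

Import Order.TTheory GRing.Theory Num.Theory.
Local Open Scope classical_set_scope.
Local Open Scope ring_scope.
Local Open Scope quotient_scope.

(* A p-adic integer, as an element of the inverse limit of the Z / p^n: its   *)
(* n-th component is its residue mod p^n, represented in [0, p^n[. The        *)
(* primality of p is a parameter of the type, since it is needed for the      *)
(* integral domain structure.                                                 *)
Record padic_int (p : nat) (hp : prime p) := PadicInt {
  res : nat -> int ;
  resP : forall n, (res n.+1 %% (p ^ n)%N)%Z = res n }.

HB.instance Definition _ p (hp : prime p) := gen_eqMixin (padic_int hp).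
HB.instance Definition _ p (hp : prime p) := gen_choiceMixin (padic_int hp).

Section PadicIntegers.
Variables (p : nat) (hp : prime p).
Implicit Types x y z : padic_int hp.

Lemma padic_int_inj x y : (forall n, res x n = res y n) -> x = y.
Proof.
case: x y => [x hx] [y hy] /= /funext exy; rewrite exy in hx *.
by congr PadicInt; exact: Prop_irrelevance.
Qed.

Lemma res_mod x n : (res x n %% (p ^ n)%N)%Z = res x n.
Proof. by rewrite -resP modz_mod. Qed.

Lemma modz_dvd (a d e : int) : (d %| e)%Z -> ((a %% e)%Z = a %[mod d])%Z.
Proof.
move=> /dvdzP[q ->]; apply/eqP; rewrite eqz_mod_dvd.
by rewrite [X in _ - X](divz_eq a (q * d)) opprD addrCA subrr addr0 rpredN dvdz_mull // dvdz_mull.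
Qed.

Lemma dvdz_expn m n : (m <= n)%N -> ((p ^ m)%N%:Z %| (p ^ n)%N%:Z)%Z.
Proof. by move=> mn; rewrite dvdzE/= dvdn_exp2l. Qed.

Lemma resPn x n k : (res x (n + k)%N %% (p ^ n)%N)%Z = res x n.
Proof.
elim: k => [|k IH]; first by rewrite addn0 res_mod.
by rewrite -IH addnS -(resP x (n + k)) modz_dvd// dvdz_expn ?leq_addr.
Qed.

Definition zp_of (f : nat -> int)
  (hf : forall n, (f n.+1 = f n %[mod (p ^ n)%N])%Z) : padic_int hp :=
  @PadicInt p hp (fun n => (f n %% (p ^ n)%N)%Z)
    (fun n => etrans (modz_dvd (f n.+1) (dvdz_expn (leqnSn n))) (hf n)).

Lemma zp_add_subproof x y n :
  (res x n.+1 + res y n.+1 = res x n + res y n %[mod (p ^ n)%N])%Z.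
Proof. by rewrite -(resP x n) -(resP y n) modzDm. Qed.
Definition zp_add x y := zp_of (zp_add_subproof x y).

Lemma zp_opp_subproof x n : (- res x n.+1 = - res x n %[mod (p ^ n)%N])%Z.
Proof. by rewrite -(resP x n) modzNm. Qed.
Definition zp_opp x := zp_of (zp_opp_subproof x).

Lemma zp_mul_subproof x y n :
  (res x n.+1 * res y n.+1 = res x n * res y n %[mod (p ^ n)%N])%Z.
Proof. by rewrite -(resP x n) -(resP y n) modzMm. Qed.
Definition zp_mul x y := zp_of (zp_mul_subproof x y).

Definition zp_const (a : int) : padic_int hp := zp_of (fun n => erefl : (a = a %[mod _])%Z).

Fact zp_addA : associative zp_add.
Proof. by move=> x y z; apply: padic_int_inj => n /=; rewrite modzDml modzDmr addrA. Qed.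
Fact zp_addC : commutative zp_add.
Proof. by move=> x y; apply: padic_int_inj => n /=; rewrite addrC. Qed.
Fact zp_add0 : left_id (zp_const 0) zp_add.
Proof. by move=> x; apply: padic_int_inj => n /=; rewrite mod0z add0r res_mod. Qed.
Fact zp_addN : left_inverse (zp_const 0) zp_opp zp_add.
Proof. by move=> x; apply: padic_int_inj => n /=; rewrite modzDml addNr. Qed.

HB.instance Definition _ :=
  GRing.isZmodule.Build (padic_int hp) zp_addA zp_addC zp_add0 zp_addN.

Fact zp_mulA : associative zp_mul.
Proof. by move=> x y z; apply: padic_int_inj => n /=; rewrite modzMml modzMmr mulrA. Qed.
Fact zp_mulC : commutative zp_mul.
Proof. by move=> x y; apply: padic_int_inj => n /=; rewrite mulrC. Qed.
Fact zp_mul1 : left_id (zp_const 1) zp_mul.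
Proof. by move=> x; apply: padic_int_inj => n /=; rewrite modzMml mul1r res_mod. Qed.
Fact zp_mulD : left_distributive zp_mul zp_add.
Proof.
by move=> x y z; apply: padic_int_inj => n /=; rewrite modzMml modzDm mulrDl.
Qed.
Fact zp_1_neq0 : zp_const 1 != 0.
Proof.
apply/eqP => /(congr1 (fun x => res x 1)) /=; rewrite expn1 mod0z.
by rewrite modz_small // ltz_nat prime_gt1.
Qed.

HB.instance Definition _ := GRing.Zmodule_isComNzRing.Build (padic_int hp)
  zp_mulA zp_mulC zp_mul1 zp_mulD zp_1_neq0.

Definition zp_unit : {pred padic_int hp} := fun x => `[< exists y, y * x = 1 >].
Definition zp_inv x : padic_int hp := if zp_unit x then xget 0 [set y | y * x = 1] else x.

Fact zp_mulVx : {in zp_unit, left_inverse 1 zp_inv *%R}.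
Proof.
move=> x ux; have ux' : zp_unit x by exact: ux.
by rewrite /zp_inv ux'; exact: xgetPex (asboolW ux').
Qed.
Fact zp_unitPl x y : y * x = 1 -> zp_unit x.
Proof. by move=> yx1; apply/asboolP; exists y. Qed.
Fact zp_inv_out : {in [predC zp_unit], zp_inv =1 id}.
Proof. by move=> x nux; rewrite /zp_inv (negbTE (nux : ~~ zp_unit x)). Qed.

HB.instance Definition _ := GRing.ComNzRing_hasMulInverse.Build (padic_int hp)
  zp_mulVx zp_unitPl zp_inv_out.

Lemma res_nat (m n : nat) : res (m%:R : padic_int hp) n = (m %% p ^ n)%N.
Proof.
elim: m => [|m IH]; first by rewrite mod0n /= mod0z.
by rewrite mulrS /= IH -modz_nat modzDm -modz_nat.
Qed.

Lemma zp_unitP (u : padic_int hp) : res u 1 != 0 -> u \is a GRing.unit.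
Proof.
move=> u0; pose f n := (egcdz (res u n) (p ^ n)%N).1.
have cop n : coprimez (res u n) (p ^ n)%N.
  case: n => [|n]; first by rewrite expn0 coprimezE coprimen1.
  rewrite coprimezE /= coprimeXr // coprime_sym prime_coprime //.
  apply: contra u0 => pu; rewrite -(resPn u 1 n) expn1 add1n.
  by apply/eqP/dvdz_mod0P; rewrite dvdzE.
have fu n : (f n * res u n = 1 %[mod (p ^ n)%N])%Z.
  rewrite /f; case: egcdzP => a b /= e _.
  have /eqP := cop n; rewrite -e => <-.
  by rewrite addrC modzMDl.
have fS n : (f n.+1 = f n %[mod (p ^ n)%N])%Z.
  apply/eqP; rewrite eqz_mod_dvd -(@Gauss_dvdzl _ _ (res u n)); last first.
    by rewrite coprimez_sym.
  rewrite mulrBl -eqz_mod_dvd fu -(resP u n) modzMmr.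
  by rewrite -(modz_dvd _ (dvdz_expn (leqnSn n))) fu modz_dvd ?dvdz_expn.
apply/asboolP; exists (zp_of fS); apply: padic_int_inj => n.
by rewrite /= modzMml fu.
Qed.

Lemma zp_decomp (x : padic_int hp) : x != 0 ->
  exists n, exists2 u : padic_int hp, u \is a GRing.unit & x = p%:R ^+ n * u.
Proof.
move=> x0; have ex : exists n, res x n.+1 != 0.
  apply: contrapT => /forallNP h; move/eqP: x0; apply.
  apply: padic_int_inj => -[|n] /=; rewrite mod0z; first by rewrite -resP modz1.
  by apply/eqP/negPn/negP/h.
case: (ex_minnP ex) => n xn nmin; exists n.
have xn0 : res x n = 0.
  case: n nmin {xn} => [_|n /(_ n) h]; first by rewrite -resP modz1.
  by apply/eqP/negPn/negP => /h; rewrite ltnn.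
have dx k : ((p ^ n)%N %| res x (n + k))%Z.
  by apply/dvdz_mod0P; rewrite resPn.
have p0 k : (p ^ k)%N%:Z != 0 by rewrite eqz_nat expn_eq0 negb_and -lt0n prime_gt0.
pose g k := (res x (n + k) %/ (p ^ n)%N)%Z.
have gE k : g k * (p ^ n)%N = res x (n + k) by rewrite divzK.
have gS k : (g k.+1 = g k %[mod (p ^ k)%N])%Z.
  apply/eqP; rewrite eqz_mod_dvd -(dvdz_mul2r (p0 n)).
  rewrite mulrBl !gE -PoszM -expnD -eqz_mod_dvd addnS addnC.
  by rewrite resP res_mod.
exists (zp_of gS).
  apply: zp_unitP => /=; apply: contra xn => /eqP/dvdz_mod0P g0.
  have : ((p ^ n.+1)%N%:Z %| g 1%N * (p ^ n)%N)%Z.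
    by rewrite expnS PoszM dvdz_mul2r //; rewrite expn1 in g0.
  by rewrite gE addn1 => /dvdz_mod0P; rewrite res_mod => ->.
apply: padic_int_inj => k /=; rewrite -natrX res_nat -modz_nat modzMml modzMmr.
by rewrite mulrC gE addnC resPn.
Qed.

Lemma zp_mul_eq0 : GRing.integral_domain_axiom (padic_int hp).
Proof.
move=> x y xy0; apply/norP => -[/zp_decomp[n [u uu ex]] /zp_decomp[m [v uv ey]]].
move: xy0; rewrite ex ey mulrACA -exprD => /(canRL (mulrK _)).
rewrite unitrM uu uv mul0r => /(_ isT) /(congr1 (fun z => res z (n + m).+1)).
rewrite -natrX res_nat /= mod0z modn_small => [/eqP|]; last first.
  by rewrite ltn_exp2l ?prime_gt1.
by rewrite eqz_nat expn_eq0 (gtn_eqF (prime_gt0 hp)).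
Qed.

HB.instance Definition _ := GRing.ComUnitRing_isIntegral.Build (padic_int hp) zp_mul_eq0.

End PadicIntegers.

Lemma fractionE (R : idomainType) (x : {fraction R}) :
  exists a, exists2 b, b != 0 & x = FracField.tofrac a / FracField.tofrac b.
Proof.
elim/quotW: x => r; exists (frac r).1, (frac r).2; first exact: denom_ratioP.
apply: (canRL (mulfK _)); first by rewrite tofrac_eq0 denom_ratioP.
rewrite !piE; apply/eqmodP => /=.
by rewrite FracField.equivfE /FracField.mulf /= !numden_Ratio
    ?(oner_neq0, mulf_neq0, denom_ratioP, mulr1, mul1r)// mulrC.
Qed.

Definition padic (p : nat) (hp : prime p) := {fraction (padic_int hp)}.

HB.instance Definition _ p (hp : prime p) := GRing.Field.on (padic hp).
HB.instance Definition _ p (hp : prime p) := isPointed.Build (padic hp) 0.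

Section PadicNumbers.
Variables (p : nat) (hp : prime p).

Definition padic_of_int (z : padic_int hp) : padic hp := @FracField.tofrac (padic_int hp) z.

HB.instance Definition _ := GRing.RMorphism.copy padic_of_int (@FracField.tofrac (padic_int hp)).

Definition padic_open : set_system (padic hp) := [set U | forall x, U x ->
  exists n : nat, forall z : padic_int hp, U (x + p%:R ^+ n * padic_of_int z)].

Fact padic_openT : padic_open setT.
Proof. by move=> x _; exists 0%N. Qed.

Fact padic_openI : setI_closed padic_open.
Proof.
move=> A B oA oB x [/oA[n An] /oB[m Bm]]; exists (n + m)%N => z; split.
  have := An (p%:R ^+ m * z); rewrite rmorphM rmorphXn rmorph_nat mulrA.
  by rewrite -exprD.
have := Bm (p%:R ^+ n * z); rewrite rmorphM rmorphXn rmorph_nat mulrA.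
by rewrite -exprD addnC.
Qed.

Fact padic_open_bigU (I : Type) (f : I -> set (padic hp)) :
  (forall i, padic_open (f i)) -> padic_open (\bigcup_i f i).
Proof. by move=> of_ x [i _ /of_[n fn]]; exists n => z; exists i. Qed.

HB.instance Definition _ :=
  isOpenTopological.Build (padic hp) padic_openT padic_openI padic_open_bigU.

Lemma padic_p_neq0 : (p%:R : padic hp) != 0.
Proof.
rewrite -(rmorph_nat padic_of_int) tofrac_eq0; apply/eqP.
move=> /(congr1 (fun z => res z 2)); rewrite res_nat /= mod0z => /eqP.
by rewrite eqz_nat modn_small ?(gtn_eqF (prime_gt0 hp)) // -[X in (X < _)%N]expn1
  ltn_exp2l ?prime_gt1.
Qed.

Lemma padic_decomp (x : padic hp) : x != 0 ->
  exists n : int, exists2 u : padic_int hp, u \is a GRing.unit &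
    x = p%:R ^ n * padic_of_int u.
Proof.
have [a [b b0 ->]] := fractionE x => x0.
have [n [u uu ->]] := zp_decomp b0.
have : a != 0 by apply: contraNneq x0 => ->; rewrite rmorph0 mul0r.
move=> /zp_decomp[m [v uv ->]].
exists (m%:Z - n%:Z); exists (v / u); first by rewrite unitrM uv unitrV.
rewrite !rmorphM !rmorphXn !rmorph_nat rmorphV //.
by rewrite invfM mulrACA expfzDr ?padic_p_neq0 // -exprnN.
Qed.

Lemma padic_int_p_nonunit (z : padic_int hp) : p%:R * z \isn't a GRing.unit.
Proof.
apply/negP => /unitrPr[y /(congr1 (fun z => res z 1))].
rewrite /= res_nat expn1 modnn mul0r mod0z mul0r mod0z.
by rewrite modz_small // ltz_nat prime_gt1.
Qed.

Definition vp (x : padic hp) : \bar int :=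
  if x == 0 then +oo%E else
  (xget 0 [set n : int | exists2 u : padic_int hp, u \is a GRing.unit &
                           x = p%:R ^ n * padic_of_int u])%:E.

Lemma vpE (n : int) (u : padic_int hp) : u \is a GRing.unit ->
  vp (p%:R ^ n * padic_of_int u) = n%:E.
Proof.
move=> uu; rewrite /vp ifF; last first.
  apply/negbTE; rewrite mulf_neq0 ?expfz_neq0 ?padic_p_neq0 // tofrac_eq0.
  by apply: contraTneq uu => ->; rewrite unitr0.
congr (_%:E); apply: xget_unique; first by exists u.
have lem (a b : int) (v w : padic_int hp) : w \is a GRing.unit ->
   p%:R ^ a * padic_of_int v = p%:R ^ b * padic_of_int w -> a <= b.
  move=> uw e; rewrite leNgt; apply/negP => ba.
  move: (padic_int_p_nonunit (p%:R ^+ `|a - b|.-1 * v)); rewrite mulrA -exprS.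
  rewrite prednK ?absz_gt0 ?subr_eq0 ?gt_eqF //.
  suff -> : p%:R ^+ `|a - b| * v = w by rewrite uw.
  apply/eqP; rewrite -(tofrac_eq (p%:R ^+ `|a - b| * v)); apply/eqP.
  rewrite -/(padic_of_int w) -/(padic_of_int _) rmorphM rmorphXn rmorph_nat.
  rewrite [LHS](_ : _ = p%:R ^ (a - b) * padic_of_int v); last first.
    by rewrite -[in RHS](gez0_abs (m := a - b)) // subr_ge0 ltW.
  by rewrite addrC expfzDr ?padic_p_neq0// -mulrA e mulrA -expfzDr ?padic_p_neq0// addNr mul1r.
move=> m [v uv e]; apply/eqP; rewrite eq_le.
by rewrite (lem _ _ _ _ uu (esym e)) (lem _ _ _ _ uv e).
Qed.

(* alpha = sum_(n >= - r) c_n p^n with digits in {- (p-1)/2, .., (p-1)/2}, for  *)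
(* the topology of Q_p. Taking r in nat is no restriction, as leading digits    *)
(* may vanish; the values of c below - r are irrelevant.                        *)
Definition balanced_expansion (alpha : padic hp) (r : nat) (c : int -> int) :=
  (forall n, (`|c n| <= p.-1./2)%N) /\
  series (fun i : nat => (c (i%:Z - r%:Z))%:~R * p%:R ^ (i%:Z - r%:Z) : padic hp)
    @ \oo --> alpha.

Lemma balanced_expansion_exists (alpha : padic hp) : odd p ->
  exists r c, balanced_expansion alpha r c.
Proof.
move=> p_odd.
have [r [z ->]] : exists r : nat, exists z : padic_int hp, alpha = p%:R ^ (- r%:Z) * padic_of_int z.
  have [->|/padic_decomp[n [u uu ->]]] := eqVneq alpha 0.
    by exists 0%N, 0; rewrite rmorph0 mulr0.
  exists `|n|%N, (p%:R ^+ `|(n + `|n|)%R|%N * u).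
  rewrite rmorphM rmorphXn rmorph_nat mulrA; congr (_ * _).
  rewrite (_ : p%:R ^+ _ = p%:R ^ (n + `|n|) :> padic hp); last first.
    rewrite -[in RHS](gez0_abs (m := n + `|n|)) //; lia.
  by rewrite -expfzDr ?padic_p_neq0 //; congr (_ ^ _); lia.
have [d [nxt [dle dE]]] : exists (d : padic_int hp -> int) (nxt : padic_int hp -> padic_int hp),
   (forall z, (`|d z| <= p.-1./2)%N) /\ forall z, z = (d z)%:~R + p%:R * nxt z.
  suff /choice[f fP] (x : padic_int hp) : exists a : int * padic_int hp,
     (`|a.1| <= p.-1./2)%N /\ x = a.1%:~R + p%:R * a.2.
    by exists (fst \o f), (snd \o f); split => x; have [] := fP x.
  have p0 := prime_gt0 hp.
  have xE (y : padic_int hp) : res y 1 = 0 -> exists w, y = p%:R * w.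
    move=> y1; have [->|y0] := eqVneq y 0; first by exists 0; rewrite mulr0.
    have [[|n] [u uu yE]] := zp_decomp y0; last first.
      by exists (p%:R ^+ n * u); rewrite mulrA -exprS.
    move: uu; rewrite expr0 mul1r in yE; rewrite -yE.
    move/unitrPr => [w /(congr1 (fun z => res z 1))] /=.
    rewrite y1 mul0r mod0z expn1 modz_small // ltz_nat prime_gt1 //.
  have ra := res_mod x 1; rewrite expn1 in ra.
  have r0 : 0 <= res x 1 by rewrite -ra modz_ge0 // eqz_nat -lt0n.
  have rp : res x 1 < p by rewrite -ra ltz_pmod // ltz_nat.
  have nat1 (m : nat) : res (m%:R : padic_int hp) 1 = (m %% p)%N by rewrite res_nat expn1.
  set m := `|res x 1|%N.
  have mE : res x 1 = m by rewrite /m gez0_abs.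
  have [w wE] : exists w, x - m%:R = p%:R * w.
    apply: xE; rewrite /= nat1 modn_small; last by rewrite -ltz_nat -mE.
    by rewrite mE expn1 modzDmr subrr mod0z.
  have xw : x = m%:R + p%:R * w by rewrite -wE addrC subrK.
  have mp : (m < p)%N by lia.
  have [mle|mgt] := leqP m p.-1./2; first by exists (m%:Z, w).
  exists (m%:Z - p%:Z, w + 1); split => /=; first lia.
  by rewrite rmorphB /= xw -!pmulrn mulrDr mulr1; ring.
pose it i := iter i nxt z.
pose c (n : int) := d (it `|(n + r%:Z)%R|%N).
exists r, c; split => [n|]; first exact: dle.
have cE (i : nat) : c (i%:Z - r%:Z) = d (it i) by rewrite /c subrK.
have part N : series (fun i : nat => (c (i%:Z - r%:Z))%:~R * p%:R ^ (i%:Z - r%:Z) : padic hp) N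
   + p%:R ^ (N%:Z - r%:Z) * padic_of_int (it N) = p%:R ^ (- r%:Z) * padic_of_int z.
  elim: N => [|N IH]; first by rewrite /series /= big_nil !add0r.
  rewrite -IH /series /= big_nat_recr //= -addrA; congr (_ + _).
  rewrite [in RHS](dE (it N)) rmorphD rmorph_int rmorphM rmorph_nat /= cE.
  rewrite mulrDr mulrC; congr (_ + _).
  by rewrite mulrA (_ : N.+1%:Z - r%:Z = N%:Z - r%:Z + 1) ?expfzDr ?padic_p_neq0 //; lia.
move=> U [B [oB Bx BU]].
have [n Bn] := oB _ Bx.
exists (n + r)%N => // N /= nN; apply: BU.
have := Bn (p%:R ^+ (N - (n + r)) * - it N); rewrite -(part N).
set S := series _ _; congr (B _).
rewrite rmorphM rmorphN rmorphXn rmorph_nat mulrA -exprD mulrN.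
have -> : N%:Z - r%:Z = (n + (N - (n + r)))%N by lia.
by rewrite addrK.
Qed.

Definition balanced_digits (alpha : padic hp) : nat * (int -> int) :=
  xget (0%N, fun=> 0) [set rc | balanced_expansion alpha rc.1 rc.2].

Definition s_part (alpha : padic hp) : padic hp :=
  let: (r, c) := balanced_digits alpha in
  \sum_(0 <= i < r.+1) (c (- i%:Z))%:~R * p%:R ^ (- i%:Z).

Definition t_part (alpha : padic hp) : padic hp :=
  let: (r, c) := balanced_digits alpha in
  \sum_(1 <= i < r.+1) (c (- i%:Z))%:~R * p%:R ^ (- i%:Z).

Definition st_part (n : nat) : padic hp -> padic hp := if odd n then t_part else s_part.

(* None once the algorithm has stopped. *)
Fixpoint complete_quotient (alpha : padic hp) (n : nat) : option (padic hp) :=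
  if n is m.+1 then
    obind (fun x => if x == st_part m x then None else Some (x - st_part m x)^-1)
      (complete_quotient alpha m)
  else Some alpha.

Definition partial_quotient (alpha : padic hp) (n : nat) : option (padic hp) :=
  omap (st_part n) (complete_quotient alpha n).

Definition padic_borel := g_sigma_algebraType (@open (padic hp)).

HB.instance Definition _ := Measurable.on padic_borel.

(* Q_p is locally compact and second countable, so regularity of mu need not be *)
(* required separately.                                                         *)
Record normalized_haar (R : realType) (mu : {measure set padic_borel -> \bar R}) :
    Prop := {
  haar_translation : forall (x : padic hp) (A : set padic_borel),
    measurable A -> mu [set x + y | y in (A : set (padic hp))] = mu A ;
  haar_compact : forall K : set (padic hp), compact K -> (mu K < +oo)%E ;
  haar_norm : mu [set p%:R * padic_of_int z | z in [set: padic_int hp]] = 1%E }.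

End PadicNumbers.

(* Main.v *)
Require Import Defs.
From mathcomp Require Import all_boot all_order all_algebra.
From mathcomp Require Import all_classical all_reals all_analysis.
From mathcomp Require Import zify ring.

Import Order.TTheory GRing.Theory Num.Theory.
Local Open Scope classical_set_scope.
Local Open Scope ring_scope.

(* The remainders [x = alpha_2i - s alpha_2i] live in [p Z_p], and one round of
   the algorithm inverts one of the maps [x |-> 1 / (a + 1 / (b + x))] with
   [v a < 0] and [v b <= 0]. Each of these maps multiplies distances in [p Z_p] by a
   constant, so it sends [p Z_p] onto a ball and scales measures by that ball's
   measure; distinct pairs [(a, b)] give disjoint balls. Those with
   [v a > - k] avoid [p^k Z_p], so their measures add up to at most
   [rho = 1 - p^(1 - k) < 1], and the points surviving [M] rounds with
   [v a_(2i+1) > - k] throughout have measure at most [rho^M] times that of the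
   ball they start in. Hence the points for which [v a_(2i+1) > - k] from some
   round on form a countable union of null sets; the expansions that stop are
   countably many. *)

Lemma subr_invE (F : fieldType) (x y : F) : x != 0 -> y != 0 ->
  x^-1 - y^-1 = - ((x - y) * y^-1 * x^-1).
Proof. by move=> x0 y0; field; apply/andP. Qed.

(** * Balls and valuations in Q_p *)

Section PadicBalls.
Context {p : nat} {hp : prime p}.
Local Notation Qp := (padic hp).
Implicit Types (x y z w : Qp) (m n : int).

Definition pball n : set Qp :=
  [set p%:R ^ n * padic_of_int z | z in [set: padic_int hp]].

Definition cball x n : set Qp := [set y | pball n (y - x)].

(** A relational valuation: no [m] works for [z = 0], and the unit is given outright instead of
    through the choice made in [vp]. *)
Definition hasval m z :=
  exists2 u : padic_int hp, u \is a GRing.unit & z = p%:R ^ m * padic_of_int u.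

Local Notation p_neq0 := (padic_p_neq0 hp).

Lemma pball0 n : pball n 0.
Proof. by exists 0 => //; rewrite rmorph0 mulr0. Qed.

Lemma pballN n x : pball n x -> pball n (- x).
Proof. by move=> [z _ <-]; exists (- z) => //; rewrite rmorphN mulrN. Qed.

Lemma pballD n x y : pball n x -> pball n y -> pball n (x + y).
Proof. by move=> [z _ <-] [w _ <-]; exists (z + w) => //; rewrite rmorphD mulrDr. Qed.

Lemma pballB n x y : pball n x -> pball n y -> pball n (x - y).
Proof. by move=> xn yn; apply: pballD => //; exact: pballN. Qed.

Lemma pballM m n x y : pball m x -> pball n y -> pball (m + n) (x * y).
Proof.
move=> [z _ <-] [w _ <-]; exists (z * w) => //.
by rewrite rmorphM expfzDr ?p_neq0 // mulrACA.
Qed.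

Lemma pball_exp n : pball n (p%:R ^ n).
Proof. by exists 1 => //; rewrite rmorph1 mulr1. Qed.

Lemma pball_padic_of_int (z : padic_int hp) : pball 0 (padic_of_int z).
Proof. by exists z => //; rewrite expr0z mul1r. Qed.

Lemma pball_int (j : int) : pball 0 j%:~R.
Proof. by have := pball_padic_of_int j%:~R; rewrite rmorph_int. Qed.

Lemma subset_pball m n : m <= n -> pball n `<=` pball m.
Proof.
move=> mn _ [z _ <-].
have -> : n = m + `|n - m|%N by lia.
rewrite expfzDr ?p_neq0 // -mulrA -[X in pball X]addr0; apply: pballM; first exact: pball_exp.
rewrite -[X in pball X]addr0; apply: pballM (pball_padic_of_int z).
by rewrite -exprnP -natrX pmulrn; exact: pball_int.
Qed.

Lemma pball_sum (I : Type) (r : seq I) (P : pred I) (F : I -> Qp) n :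
  (forall i, P i -> pball n (F i)) -> pball n (\sum_(i <- r | P i) F i).
Proof. by move=> h; apply: big_ind => //; [exact: pball0|exact: pballD]. Qed.

Lemma cball_open x n : open (cball x n).
Proof.
rewrite openE => y xy; rewrite /interior nbhsE; exists (cball x n) => //; split => //.
move=> z xz; exists `|n|%N => w; rewrite /cball /= -addrAC; apply: pballD => //.
apply: (@subset_pball _ (`|n|%N%:Z + 0)); first lia.
exact: pballM (pball_exp `|n|%N) (pball_padic_of_int w).
Qed.

Lemma pball_dvdn (e m : nat) : pball e (m%:R) -> (p ^ e %| m)%N.
Proof.
move=> [z _ /eqP]; rewrite -exprnP -(rmorph_nat (@padic_of_int p hp) m).
rewrite -(rmorph_nat (@padic_of_int p hp) p) -rmorphXn -rmorphM tofrac_eq => /eqP.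
move=> /(congr1 (fun v => res v e)); rewrite -natrX /= !res_nat modnn mul0r mod0z => /eqP.
by rewrite eqz_nat eq_sym.
Qed.

Lemma padic_int_unitVp (z : padic_int hp) :
  z \isn't a GRing.unit -> exists v, z = p%:R * v.
Proof.
have [->|/zp_decomp[[|n] [u uu ->]]] := eqVneq z 0.
- by exists 0; rewrite mulr0.
- by rewrite expr0 mul1r uu.
- by exists (p%:R ^+ n * u); rewrite mulrA exprS.
Qed.

Lemma hasval_neq0 m z : hasval m z -> z != 0.
Proof.
move=> [u uu ->]; rewrite mulf_neq0 ?expfz_neq0 ?p_neq0 // tofrac_eq0.
by apply: contraTneq uu => ->; rewrite unitr0.
Qed.

Lemma hasval_pball m z : hasval m z -> pball m z.
Proof. by move=> [u _ ->]; exists u. Qed.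

Lemma hasval_exists z : z != 0 -> exists m, hasval m z.
Proof. by move=> /padic_decomp[n [u uu ->]]; exists n; exists u. Qed.

Lemma hasvalV m z : hasval m z -> hasval (- m) z^-1.
Proof.
move=> [u uu ->]; exists u^-1; first by rewrite unitrV.
by rewrite rmorphV // invfM invr_expz.
Qed.

Lemma hasval_le m n z : hasval m z -> pball n z -> n <= m.
Proof.
move=> [u uu zE] zn; rewrite leNgt; apply/negP => mn.
have : pball (m + 1) (p%:R ^ m * padic_of_int u) by rewrite -zE; apply: subset_pball zn; lia.
move=> [w _]; rewrite expfzDr ?p_neq0 // expr1z -mulrA.
move/(mulfI (expfz_neq0 m p_neq0)) => /eqP.
rewrite -(rmorph_nat (@padic_of_int p hp)) -rmorphM tofrac_eq => /eqP uE.
by have := padic_int_p_nonunit w; rewrite uE uu.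
Qed.

Lemma hasvalD m n z w : hasval m z -> pball n w -> m < n -> hasval m (z + w).
Proof.
move=> [u uu ->] wn mn; have [v _ <-] : pball (m + 1) w by apply: subset_pball wn; lia.
exists (u + p%:R * v); last first.
  by rewrite rmorphD rmorphM rmorph_nat mulrDr expfzDr ?p_neq0 // expr1z mulrA.
apply/negPn/negP => /padic_int_unitVp[t tE].
have := padic_int_p_nonunit (t - v).
by rewrite mulrBr -tE addrK uu.
Qed.

Lemma hasval_notin m n z : hasval m z -> ~ pball n z -> m < n.
Proof.
move=> zm zn; rewrite ltNge; apply/negP => nm; apply: zn.
exact: subset_pball (hasval_pball _ _ zm).
Qed.

Lemma pball_hasval m x : x != 0 -> pball m x -> exists m' : nat, hasval (m + m') x.
Proof.
move=> /hasval_exists[n hx] /(hasval_le _ _ _ hx) mn.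
by exists `|n - m|%N; rewrite (_ : m + `|n - m|%N = n) //; lia.
Qed.

Lemma vp_le n z : ~ pball (n + 1) z -> (vp z <= n%:E)%E.
Proof.
move=> zn; have z0 : z != 0 by apply: contra_notN zn => /eqP ->; exact: pball0.
have [m zm] := hasval_exists _ z0; have := hasval_notin _ _ _ zm zn.
by case: zm => u uu ->; rewrite vpE // lee_fin; lia.
Qed.

Lemma cball_shift a x n : (fun y => a + y) @` cball x n = cball (a + x) n.
Proof.
apply/seteqP; split => [_ [y xy <-]|y xy]; first by rewrite /cball /= opprD addrACA subrr add0r.
by exists (y - a); [move: xy; rewrite /cball /= opprD addrA|rewrite addrC subrK].
Qed.

(** As [w - z] has larger valuation than [z], [w] has valuation [m] too, and 1/w - 1/z = -(w -
    z)/(zw) lies in p^(n - 2m) Z_p. *)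
Lemma pball_invB m n z w : hasval m z -> m < n -> cball z n w ->
  cball z^-1 (n - m - m) w^-1.
Proof.
move=> zm mn zw; have wE : w = z + (w - z) by rewrite addrC subrK.
have wm : hasval m w by rewrite wE; exact: hasvalD mn.
have z0 := hasval_neq0 _ _ zm; have w0 := hasval_neq0 _ _ wm.
rewrite /cball /= subr_invE //.
by apply/pballN/pballM; [apply: pballM => //|]; apply/hasval_pball/hasvalV.
Qed.

Lemma cball_inv m n z : hasval m z -> m < n ->
  GRing.inv @` cball z n = cball z^-1 (n - m - m).
Proof.
move=> zm mn; apply/seteqP; split => [_ [w zw <-]|w zw]; first exact: pball_invB zw.
exists w^-1; last exact: invrK.
(* Inversion is an involution, and a second use at valuation [- m] brings the exponent [n - m - m]
   back to [n]. *)
have := @pball_invB (- m) (n - m - m) z^-1 w; rewrite invrK.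
by rewrite (_ : n - m - m - - m - - m = n); [apply=> //; [exact: hasvalV|lia]|lia].
Qed.

(** Asking for images equal to balls makes them measurable with known measure, and lets the
    exponents [s] add under composition. *)
Definition scaled (f : Qp -> Qp) (s : nat) := forall x n, pball 1 x -> 1 <= n ->
  f @` cball x n = cball (f x) (n + s).

Lemma scaled_shift a : scaled (fun x => a + x) 0.
Proof. by move=> x n _ _; rewrite cball_shift addr0. Qed.

Lemma scaled_comp f g s t : scaled f s -> scaled g t ->
  (forall x, pball 1 x -> pball 1 (g x)) -> scaled (f \o g) (s + t).
Proof.
move=> fs gt g1 x n x1 n1.
by rewrite -image_comp gt // fs; [congr (cball _ _); lia|exact: g1|lia].
Qed.

Definition cf2 (a b x : Qp) : Qp := (a + (b + x)^-1)^-1.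

(** The inverse of [b + x] has valuation [mb >= 0], too large to disturb the negative valuation of
    [a]. *)
Lemma cf2P (ma mb : nat) a b : hasval (- ma.+1%:Z) a -> hasval (- mb%:Z) b ->
  [/\ exists s, scaled (cf2 a b) s,
      forall x, pball 1 x -> pball 0 (b + x)^-1 &
      forall x, pball 1 x -> hasval ma.+1 (cf2 a b x)].
Proof.
move=> ha hb.
have bx x : pball 1 x -> hasval mb (b + x)^-1.
  by move=> x1; rewrite -[mb%:Z]opprK; apply/hasvalV/(hasvalD _ _ _ _ hb x1); lia.
have bx0 x : pball 1 x -> pball 0 (b + x)^-1.
  by move=> /bx /hasval_pball; exact: subset_pball.
have ax x : pball 1 x -> hasval (- ma.+1%:Z) (a + (b + x)^-1).
  by move=> /bx0 xb; apply: hasvalD ha xb _; lia.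
split => // [|x /ax /hasvalV]; last by rewrite opprK.
(* Inverting around a point of valuation m lowers the exponent by 2m; here m is first [mb] with a
   minus sign, then [ma.+1] with a minus sign. *)
exists (ma.+1 + ma.+1 + mb + mb)%N => x n x1 n1.
have -> : cf2 a b @` cball x n = GRing.inv @` ((fun y => a + y) @`
    (GRing.inv @` ((fun y => b + y) @` cball x n))) by rewrite !image_comp.
rewrite cball_shift (@cball_inv (- mb%:Z)); last lia; last first.
  by rewrite -[X in hasval _ X]invrK; apply/hasvalV/bx.
rewrite cball_shift (@cball_inv (- ma.+1%:Z)); [|exact: ax|lia].
by congr (cball _ _); lia.
Qed.

End PadicBalls.

(** * Values of s and t *)

Section BalancedFractions.
Context {p : nat} {hp : prime p}.
Local Notation Qp := (padic hp).
Implicit Types (x y z : Qp) (n : int).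

(* [bfrac 0] contains the values of [t], and [bfrac 1] those of [s]; the size
   bound makes them representatives of distinct classes modulo [p^e Z_p]. *)
Definition bfrac (e : nat) : set Qp := [set x | exists m (j : int),
  (2 * `|j| < p ^ (m + e))%N /\ x = j%:~R * p%:R ^ (- m%:Z)].

Local Notation p_neq0 := (padic_p_neq0 hp).

Lemma bfrac_countable e : countable (bfrac e).
Proof.
pose f (mj : nat * int) : Qp := mj.2%:~R * p%:R ^ (- mj.1%:Z).
apply: (@sub_countable _ _ _ [set: nat * int]); last exact: countableP.
apply: (card_le_trans _ (card_image_le f [set: nat * int])).
by apply: subset_card_le => x [m [j [_ ->]]]; exists (m, j).
Qed.

(** Over the common denominator p^(m + m'), both numerators are below p^(e + m + m') / 2 in absolute
    value, while that same power of p divides their difference. *)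
Lemma bfrac_inj e x y : bfrac e x -> bfrac e y -> pball e (x - y) -> x = y.
Proof.
move=> [m [j [jm ->]]] [m' [j' [jm' ->]]] xy.
have pe (a b : nat) : p%:R ^ (- a%:Z) = (p ^ b)%N%:~R * p%:R ^ (- (a + b)%N%:Z) :> Qp.
  rewrite -pmulrn natrX exprnP -expfzDr ?p_neq0 //; congr (_ ^ _); lia.
have pgt0 k : (0 < p ^ k)%N by rewrite expn_gt0 prime_gt0.
move: xy; rewrite (pe m m') (pe m' m) !mulrA -!intrM [(m' + m)%N]addnC -mulrBl.
set J := j * _; set J' := j' * _; rewrite -intrB => /(pballM _ (m + m')%N _ _)/(_ (pball_exp _)).
rewrite -mulrA -expfzDr ?p_neq0 // addNr mulr1 => JJ.
suff -> : J = J' by [].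
have : (p ^ (e + (m + m')) %| `|J - J'|)%N.
  apply: (@pball_dvdn p hp); move: JJ; case: (J - J') => k; first by rewrite -pmulrn.
  by rewrite NegzE rmorphN /= -pmulrn => /pballN; rewrite opprK.
have {}jm : (2 * `|J| < p ^ (e + (m + m')))%N.
  rewrite /J abszM /= mulnA (_ : e + (m + m') = m + e + m')%N; last lia.
  by rewrite expnD ltn_pmul2r.
have {}jm' : (2 * `|J'| < p ^ (e + (m + m')))%N.
  rewrite /J' abszM /= mulnA (_ : e + (m + m') = m' + e + m)%N; last lia.
  by rewrite expnD ltn_pmul2r.
move: jm jm'; set P := (p ^ _)%N => jm jm' dv.
have [|?] := posnP `|J - J'|%N; first lia.
have := dvdn_leq _ dv; lia.
Qed.

Context (p_odd : odd p).

(** Horner's scheme: 2|j| <= p^r - 1 and 2|c r| <= p - 1 give 2|pj + c r| <= p^(r+1) - 1. *)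
Lemma digit_sum_bfrac (c : nat -> int) r : (forall i, `|c i| <= p.-1./2)%N ->
  exists2 j : int, (2 * `|j| < p ^ r)%N &
    \sum_(0 <= i < r) (c i)%:~R * p%:R ^ (- i.+1%:Z) = j%:~R * p%:R ^ (- r%:Z) :> Qp.
Proof.
move=> cp; elim: r => [|r [j jr IH]]; first by exists 0; rewrite ?big_nil ?mul0r.
exists (p%:Z * j + c r); last first.
  rewrite big_nat_recr //= IH [in RHS]rmorphD rmorphM /= mulrDl; congr (_ + _).
  rewrite mulrAC -pmulrn mulrC; congr (_ * _).
  rewrite -[X in X * _]expr1z -expfzDr ?p_neq0 //; congr (_ ^ _); lia.
have := cp r; have := prime_gt0 hp; rewrite expnS.
move: (p ^ r)%N jr => P jr p0 cr.
have -> : (p = (p.-1./2).*2.+1)%N by have := odd_double_half p; lia.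
move: (p.-1./2) cr => h cr; nia.
Qed.

Lemma balanced_digitsP x :
  balanced_expansion x (balanced_digits x).1 (balanced_digits x).2.
Proof.
rewrite /balanced_digits; case: xgetP => [rc _ //|].
have [r [c h]] := balanced_expansion_exists x p_odd.
by move/(_ (r, c)).
Qed.

Lemma t_part_bfrac x : bfrac 0 (t_part x).
Proof.
rewrite /t_part; have := balanced_digitsP x; case: (balanced_digits x) => r c /= [cp _].
have [|j jr jE] := @digit_sum_bfrac (fun i => c (- i.+1%:Z)) r; first by move=> i; exact: cp.
by exists r, j; rewrite addn0 big_add1.
Qed.

Lemma s_part_bfrac x : bfrac 1 (s_part x).
Proof.
rewrite /s_part; have := balanced_digitsP x; case: (balanced_digits x) => r c /= [cp _].
have [|j jr jE] := @digit_sum_bfrac (fun i => c (- i%:Z)) r.+1; first by move=> i; exact: cp.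
exists r, j; split; first by rewrite addn1.
(* Division by p moves the exponents 0, .., -r to the range -1, .., -(r+1) of [digit_sum_bfrac]. *)
apply: (mulIf (expfz_neq0 (-1) p_neq0)); rewrite big_distrl /=.
rewrite -mulrA -expfzDr ?p_neq0 // (_ : - r%:Z + -1 = - r.+1%:Z); last lia.
rewrite -jE; apply: eq_bigr => i _; rewrite -mulrA -expfzDr ?p_neq0 //.
by congr (_ * _ ^ _); lia.
Qed.

(** A far partial sum of the expansion lies in x + p Z_p; its first [r.+1] terms add up to
    [s_part x], and the others carry positive powers of p. *)
Lemma s_partB x : pball 1 (x - s_part x).
Proof.
rewrite /s_part; have := balanced_digitsP x; case: (balanced_digits x) => r c /= [cp].
move=> /(_ (cball x 1)) [].
  by apply: open_nbhs_nbhs; split; [exact: cball_open|rewrite /cball /= subrr; exact: pball0].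
move=> N _ /(_ (N + r.+1)%N (leq_addr _ _)); rewrite /cball /series /=.
rewrite (@big_cat_nat _ _ _ r.+1) ?leq_addl //=.
(* The expansion runs upwards from exponent [- r], the sum in [s_part] downwards from 0. *)
rewrite [X in X + _ - _]big_nat_rev /= add0n.
rewrite [X in X + _ - _](eq_big_nat _ _ (F2 := fun i : nat =>
  (c (- i%:Z))%:~R * p%:R ^ (- i%:Z))); last first.
  move=> i /andP[_ ir]; congr ((c _)%:~R * _ ^ _); lia.
set s := \sum_(0 <= i < r.+1) _; set u := \sum_(_ <= i < _) _ => sux.
have -> : x - s = u - (s + u - x) by rewrite opprB opprD [RHS]addrC !addrA subrK.
apply: pballB => //; rewrite /u big_nat_cond; apply: pball_sum => i /andP[/andP[ri _] _].
rewrite -[1]add0r; apply: pballM (pball_int _) _.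
by apply: subset_pball (pball_exp _); lia.
Qed.

(** The two parts differ by the digit [c 0], an integer. *)
Lemma t_partB x : pball 0 (x - t_part x).
Proof.
have := s_partB x; rewrite /t_part /s_part; case: (balanced_digits x) => r c /=.
rewrite big_ltn // oppr0 expr0z mulr1 opprD addrA addrAC => h.
rewrite -[x - _](subrK (c 0)%:~R); apply: pballD (pball_int _).
exact: (@subset_pball p hp 0 1).
Qed.

End BalancedFractions.

(** * Measures of countable unions and of balls *)

Section CountableUnions.
Context {d : measure_display} {T : measurableType d} {R : realType}.
Context (mu : {measure set T -> \bar R}).

(** Padding with [None] treats finite and infinite sets alike; the absence of repetitions preserves
    disjointness of families. *)
Lemma countable_enum {I : choiceType} (C : set I) : countable C ->
  exists e : nat -> option I, [/\ forall n c, e n = Some c -> C c,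
    forall c, C c -> exists n, e n = Some c &
    forall n m c, e n = Some c -> e m = Some c -> n = m].
Proof.
move=> /countable_injP[f finj].
pose e n := xget None [set o | exists c, [/\ o = Some c, C c & f c = n]].
have eP n c : e n = Some c -> C c /\ f c = n.
  by rewrite /e; case: xgetP => // o _ [c' [-> Cc' fc']] [<-].
exists e; split => [n c /eP[]//|c Cc|n m c /eP[_ <-] /eP[_ <-]//].
exists (f c); rewrite /e; case: xgetP => [b _ [c' [-> Cc' fc']]|h].
  by congr Some; apply: finj; rewrite ?inE.
by case: (h (Some c)); exists c.
Qed.

Lemma bigcup_enum {I : choiceType} {C : set I} {e : nat -> option I} (G : I -> set T) :
  (forall n c, e n = Some c -> C c) -> (forall c, C c -> exists n, e n = Some c) ->
  \bigcup_(c in C) G c = \bigcup_n (if e n is Some c then G c else set0).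
Proof.
move=> eC Ce; apply/seteqP; split => [x [c /Ce[n en] Gx]|x [n _]].
  by exists n => //; rewrite en.
by case en: (e n) => [c|//] Gx; exists c => //; exact: eC en.
Qed.

Lemma countable_bigcup_measurable {I : choiceType} {C : set I} (G : I -> set T) :
  countable C -> (forall c, C c -> measurable (G c)) -> measurable (\bigcup_(c in C) G c).
Proof.
move=> /countable_enum[e [eC Ce _]] mG; rewrite (bigcup_enum G eC Ce).
by apply: bigcupT_measurable => n; case en: (e n) => [c|//]; exact/mG/eC/en.
Qed.

(** Subadditivity bounds the left side by the sum of the [mu (G c)]; disjointness turns the right
    side into [r] times the sum of the [mu (H c)]. *)
Lemma le_measure_bigcup {I : choiceType} {C : set I} {G H : I -> set T} {r : R} :
  countable C -> 0 <= r ->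
  (forall c, C c -> [/\ measurable (G c), measurable (H c) & (mu (G c) <= r%:E * mu (H c))%E]) ->
  trivIset C H ->
  (mu (\bigcup_(c in C) G c) <= r%:E * mu (\bigcup_(c in C) H c))%E.
Proof.
move=> /countable_enum[e [eC Ce einj]] r0 GH tH.
rewrite (bigcup_enum G eC Ce) (bigcup_enum H eC Ce).
set g := fun n => if e n is Some c then G c else set0.
set h := fun n => if e n is Some c then H c else set0.
have mg n : measurable (g n) by rewrite /g; case en: (e n) => [c|//]; have [] := GH _ (eC _ _ en).
have mh n : measurable (h n) by rewrite /h; case en: (e n) => [c|//]; have [] := GH _ (eC _ _ en).
have gh n : (mu (g n) <= r%:E * mu (h n))%E.
  rewrite /g /h; case en: (e n) => [c|]; first by have [] := GH _ (eC _ _ en).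
  by rewrite !measure0 mule0.
rewrite (@measure_semi_bigcup _ _ _ mu h) //; last 2 first.
- apply/trivIsetP => i j _ _; rewrite /h; case ei: (e i) => [c|]; last by rewrite set0I.
  case ej: (e j) => [c'|]; last by rewrite setI0.
  move=> ij; move/trivIsetP: tH; apply; [exact: eC ei|exact: eC ej|].
  by apply: contra ij => /eqP cc'; rewrite cc' in ei; rewrite (einj _ _ _ ei ej).
- exact: bigcupT_measurable.
rewrite -nneseriesZl //; apply: (@le_trans _ _ (\sum_(0 <= n <oo) mu (g n))%E).
  by apply: measure_sigma_subadditive => //; exact: bigcupT_measurable.
by apply: lee_nneseries => n _; [move=> _; exact: measure_ge0|exact: gh].
Qed.

Lemma negligible_countable_bigcup {I : choiceType} {C : set I} (G : I -> set T) :
  countable C -> (forall c, C c -> mu.-negligible (G c)) ->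
  mu.-negligible (\bigcup_(c in C) G c).
Proof.
move=> /countable_enum[e [eC Ce _]] nG; rewrite (bigcup_enum G eC Ce).
apply: negligible_bigcup => n; case en: (e n) => [c|]; last exact: negligible_set0.
exact/nG/eC/en.
Qed.

(** The intersection of the [W n] covers [A], and its measure is below every [c * q ^+ n], hence
    zero in the limit. *)
Lemma negligible_geometric (A : set T) (W : nat -> set T) (c q : R) :
  0 <= q < 1 -> (forall n, A `<=` W n) -> (forall n, measurable (W n)) ->
  (forall n, mu (W n) <= (c * q ^+ n)%:E)%E -> mu.-negligible A.
Proof.
move=> /andP[q0 q1] AW mW Wle; exists (\bigcap_n W n); split.
- exact: bigcapT_measurable.
- apply/eqP; rewrite eq_le measure_ge0 andbT.
  have mWn n : (mu (\bigcap_n W n) <= (c * q ^+ n)%:E)%E.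
    apply: le_trans (Wle n); apply: le_measure; rewrite ?inE //.
      exact: bigcapT_measurable.
    by apply: bigcap_inf.
  have fin : (mu (\bigcap_n W n) \is a fin_num)%E.
    by rewrite ge0_fin_numE //; apply: le_lt_trans (mWn 0%N) (ltry _).
  rewrite -(fineK fin) lee_fin.
  have := @cvg_geometric R c q; rewrite ger0_norm // => /(_ q1) cvg0.
  apply: (cvgr_to_ge cvg0); apply: nearW => n.
  by rewrite -lee_fin fineK //; exact: mWn.
- by move=> x Ax n _; exact: AW.
Qed.

End CountableUnions.

Lemma sume_cst_ord {R : realDomainType} n (x : \bar R) :
  (\sum_(i < n) x = n%:R%:E * x)%E.
Proof.
by rewrite mule_natl; elim: n => [|n IH]; rewrite ?big_ord0 // big_ord_recl IH muleS.
Qed.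

Section HaarMeasure.
Context {R : realType} {p : nat} {hp : prime p}.
Context {mu : {measure set (padic_borel hp) -> \bar R}} (mu_haar : normalized_haar mu).
Local Notation Qp := (padic hp).
Local Notation p_neq0 := (padic_p_neq0 hp).
Implicit Types (x y z : Qp) (n : int).

Lemma cball_measurable x n : measurable (cball x n : set (padic_borel hp)).
Proof. by apply: sub_sigma_algebra; exact: cball_open. Qed.

Lemma haar_cball x n : mu (cball x n) = mu (pball n).
Proof.
rewrite -(haar_translation mu_haar x (A := pball n)); last first.
  have := cball_measurable 0 n; congr measurable; apply/seteqP.
  by split => y; rewrite /cball /= subr0.
congr (mu _); apply/seteqP; split => [y xy|_ [y yn <-]].
  by exists (y - x) => //; rewrite addrC subrK.
by rewrite /cball /= addrAC subrr add0r.
Qed.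

Lemma padic_int_residue (z : padic_int hp) :
  exists (j : 'I_p) (w : padic_int hp), z = j%:R + p%:R * w.
Proof.
have r0 : 0 <= res z 1 by rewrite -res_mod modz_ge0 // expn1 eqz_nat -lt0n prime_gt0.
have rp : (`|res z 1| < p)%N.
  by rewrite -ltz_nat gez0_abs // -res_mod expn1 ltz_pmod // ltz_nat prime_gt0.
exists (Ordinal rp) => /=; set m := `|res z 1|%N.
have [|w wE] := @padic_int_unitVp p hp (z - m%:R); last by exists w; rewrite -wE addrC subrK.
apply/negP => /unitrPr[y /(congr1 (fun v => res v 1))] /=.
rewrite res_nat expn1 [(m %% p)%N]modn_small // gez0_abs // modzDmr subrr mod0z.
by rewrite mul0r mod0z modz_small // ltz_nat prime_gt1.
Qed.

Lemma pball_split n :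
  pball n = \big[setU/set0]_(j < p) cball (j%:R * p%:R ^ n : Qp) (n + 1).
Proof.
rewrite -(bigcup_mkord p (fun j : nat => cball (j%:R * p%:R ^ n : Qp) (n + 1))).
apply/seteqP; split.
  move=> _ [z _ <-]; have [j [w ->]] := padic_int_residue z.
  exists j => /=; first exact: ltn_ord.
  exists w => //; rewrite rmorphD rmorphM !rmorph_nat expfzDr ?p_neq0 // expr1z.
  by rewrite mulrDr [_ * j%:R]mulrC [RHS]addrAC subrr add0r mulrA.
move=> y [j _] yj; rewrite -[y](subrK (j%:R * p%:R ^ n)); apply: pballD.
  by apply: subset_pball yj; lia.
by rewrite -[X in pball X]add0r pmulrn; apply: pballM (pball_int _) (pball_exp _).
Qed.

Lemma residue_inj (i j : nat) : (i < p)%N -> (j < p)%N ->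
  pball 1 (i%:R - j%:R : Qp) -> i = j.
Proof.
wlog ij : i j / (j <= i)%N => [hw ip jp h|ip _].
  have [/hw|/ltnW/hw e] := leqP j i; first exact.
  by apply/esym/e => //; rewrite -opprB; exact: pballN.
rewrite -natrB // => /(@pball_dvdn p hp 1); rewrite expn1 => dv.
have [|?] := posnP (i - j)%N; first lia.
have := dvdn_leq _ dv; lia.
Qed.

(** The p residue classes of p^n Z_p are disjoint translates of p^(n+1) Z_p. *)
Lemma haar_pballS n : mu (pball n) = (p%:R%:E * mu (pball (n + 1)))%E.
Proof.
rewrite pball_split measure_semi_additive_ord.
- rewrite (eq_bigr (fun=> mu (pball (n + 1)))); last by move=> i _; exact: haar_cball.
  exact: sume_cst_ord.
- by move=> j; exact: cball_measurable.
- apply/trivIsetP => i j _ _ ij; rewrite -subset0 => y [yi yj].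
  move/negP: ij; apply; apply/eqP/val_inj/residue_inj; rewrite ?ltn_ord //.
  (* A common point puts (i - j) p^n in p^(n+1) Z_p; dividing by p^n gives i = j modulo p. *)
  have := pballM _ (- n) _ _ (pballB _ _ _ yj yi) (pball_exp _).
  rewrite opprD opprK [y - _ + _]addrACA subrr add0r [- _ + _]addrC -mulrBl.
  rewrite -mulrA -expfzDr ?p_neq0 // subrr mulr1.
  by rewrite addrAC subrr add0r.
- by apply: bigsetU_measurable => j _; exact: cball_measurable.
Qed.

(** The induction starts from the normalization on p Z_p, hence the exponent [m.+1]. *)
Lemma haar_ball x m : mu (cball x m.+1) = ((p%:R ^+ m)^-1)%:E.
Proof.
rewrite haar_cball; elim: m => [|m IH].
  by rewrite expr0 invr1 /pball expr1z; exact: haar_norm mu_haar.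
have p0 : (p%:R : R) != 0 by rewrite pnatr_eq0 -lt0n prime_gt0.
have := haar_pballS m.+1; rewrite IH (_ : m.+1%:Z + 1 = m.+2); last lia.
case: (mu _) => [r [E]||] //.
- by rewrite exprS invfM E mulKf.
- by rewrite mulry gtr0_sg ?ltr0n ?prime_gt0 // mul1e.
- by rewrite mulrNy gtr0_sg ?ltr0n ?prime_gt0 // mul1e.
Qed.

End HaarMeasure.

(** * Runs of small odd partial quotients *)

Section Survival.
Context {p : nat} {hp : prime p}.
Local Notation Qp := (padic hp).
Implicit Types (x y z : Qp) (n : int) (f : Qp -> Qp).

(** Candidates for [(a_(2i+1), a_(2i+2))], described by shape and valuation alone. *)
Definition quotient_pair : set (Qp * Qp) := [set ab |
  [/\ bfrac 0 ab.1, bfrac 1 ab.2, exists m : nat, hasval (- m.+1%:Z) ab.1 &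
      exists m : nat, hasval (- m%:Z) ab.2]].

Lemma quotient_pair_countable : countable quotient_pair.
Proof.
apply: (@sub_countable _ _ _ ((bfrac 0 : set Qp) `*` (bfrac 1 : set Qp))).
  by apply: subset_card_le => -[a b] [].
by apply: countableX; exact: bfrac_countable.
Qed.

Lemma quotient_pairP ab : quotient_pair ab ->
  (exists s, scaled (cf2 ab.1 ab.2) s) /\ (forall x, pball 1 x -> pball 1 (cf2 ab.1 ab.2 x)).
Proof.
move=> [_ _ [ma ha] [mb hb]]; have [sc _ hv] := cf2P _ _ _ _ ha hb; split => // x /hv/hasval_pball.
by apply: subset_pball; lia.
Qed.

Lemma scaled_image {f s} : scaled f s -> f @` pball 1 = cball (f 0) s.+1.
Proof.
move=> fs; have := fs 0 1 (pball0 1) isT; rewrite (_ : 1 + s%:Z = s.+1); last lia.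
by move=> <-; congr (_ @` _); apply/seteqP; split => y; rewrite /cball /= subr0.
Qed.

(** At a common point, [a - a'] is a difference of elements of Z_p, so [a = a']; then
    [b - b' = x' - x] lies in p Z_p, so [b = b']. *)
Lemma trivIset_cf2 : trivIset quotient_pair (fun ab => cf2 ab.1 ab.2 @` pball 1).
Proof.
move=> [a b] [a' b'] [/= fa fb [ma ha] [mb hb]] [/= fa' fb' [ma' ha'] [mb' hb']].
have [_ ib _] := cf2P _ _ _ _ ha hb; have [_ ib' _] := cf2P _ _ _ _ ha' hb'.
move=> [_ [[x x1 <-] [x' x1' /invr_inj e]]].
have aa' : a = a'.
  apply: (bfrac_inj _ _ _ fa fa').
  have -> : a - a' = (b' + x')^-1 - (b + x)^-1.
    by apply/eqP; rewrite subr_eq addrAC eq_sym subr_eq addrC e addrC.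
  by apply: pballB; [exact: ib'|exact: ib].
move: e; rewrite aa' => /addrI/invr_inj e; congr pair; apply: (bfrac_inj _ _ _ fb fb').
have -> : b - b' = x' - x.
  by apply/eqP; rewrite subr_eq addrAC eq_sym subr_eq addrC e addrC.
exact: pballB.
Qed.

Context (k : nat).

Definition small_pair : set (Qp * Qp) :=
  [set ab | quotient_pair ab /\ pball (1 - k%:Z) ab.1].

(* The image under [f] of the points of [p Z_p] whose next [M] odd partial
   quotients exist and have valuation [> - k]. *)
Fixpoint survivors (M : nat) (f : Qp -> Qp) : set Qp :=
  if M is M'.+1 then \bigcup_(ab in small_pair) survivors M' (f \o cf2 ab.1 ab.2)
  else f @` pball 1.

Lemma small_pair_countable : countable small_pair.
Proof.
apply: sub_countable quotient_pair_countable.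
by apply: subset_card_le => ab [].
Qed.

Context {R : realType} {mu : {measure set (padic_borel hp) -> \bar R}}.
Context (mu_haar : normalized_haar mu) (k_ge1 : (1 <= k)%N).

Lemma haar_scaled_image {f s} : scaled f s ->
  measurable (f @` pball 1 : set (padic_borel hp)) /\ mu (f @` pball 1) = ((p%:R ^+ s)^-1)%:E.
Proof.
by move=> fs; rewrite (scaled_image fs); split; [exact: cball_measurable|exact: haar_ball].
Qed.

(** The measure of p Z_p with p^k Z_p removed. *)
Let rho : R := 1 - (p%:R ^+ k.-1)^-1.

Lemma rho_itv : 0 <= rho < 1.
Proof.
have p0 : 0 < (p%:R : R) ^+ k.-1 by rewrite exprn_gt0 // ltr0n prime_gt0.
rewrite /rho subr_ge0 ltrBlDr ltrDl invr_gt0 p0 andbT invf_le1 //.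
by rewrite exprn_ege1 // ler1n prime_gt0.
Qed.

Let cylinders : set Qp := \bigcup_(ab in small_pair) (cf2 ab.1 ab.2 @` pball 1).

Lemma haar_cylinders : (mu cylinders <= rho%:E)%E.
Proof.
have mc : measurable (cylinders : set (padic_borel hp)).
  apply: countable_bigcup_measurable; first exact: small_pair_countable.
  by move=> ab [/quotient_pairP[[s /haar_scaled_image[]]]].
have pb m : pball m = cball (0 : Qp) m.
  by apply/seteqP; split => y; rewrite /cball /= subr0.
have mp m : measurable (pball m : set (padic_borel hp)) by rewrite pb; exact: cball_measurable.
have muk : mu (pball k) = ((p%:R ^+ k.-1)^-1)%:E.
  by rewrite pb -[in LHS](prednK k_ge1); exact: haar_ball.
have mu1 : mu (pball 1) = 1%E by rewrite pb (haar_ball mu_haar 0 0) expr0 invr1.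
(* A point of a cylinder has valuation [- v(a)], at most [k - 1] for a small pair. *)
have disj : cylinders `&` pball k = set0.
  rewrite -subset0 => _ [[[a b] [[_ _ [ma ha] [mb hb]] sa] [x x1 <-]] yk].
  have [_ _ /(_ x x1) hv] := cf2P _ _ _ _ ha hb.
  have := hasval_le _ _ _ ha sa; have := hasval_le _ _ _ hv yk; lia.
have : (mu cylinders + mu (pball k) <= 1)%E.
  rewrite -measureU // -mu1; apply: le_measure; rewrite ?inE //; first exact: measurableU.
  move=> y [[ab [/quotient_pairP[_ h] _] [x x1 <-]]|]; first exact: h.
  by apply: subset_pball; lia.
by rewrite muk /rho EFinB leeBrDr.
Qed.

(** By induction each branch contributes at most p^(-s) rho^M times the measure of its cylinder;
    summing over the disjoint cylinders yields one more factor [rho]. *)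
Lemma haar_survivors M f s : scaled f s ->
  measurable (survivors M f : set (padic_borel hp)) /\
  (mu (survivors M f) <= (((p%:R ^+ s)^-1) * rho ^+ M)%:E)%E.
Proof.
elim: M f s => [|M IH] f s fs.
  by have [mf mu_f] := haar_scaled_image fs; rewrite expr0 mulr1 /= mu_f.
have /andP[rho0 _] := rho_itv.
have c0 : 0 <= (p%:R ^+ s)^-1 * rho ^+ M :> R.
  by rewrite mulr_ge0 ?exprn_ge0 // invr_ge0 exprn_ge0.
have step ab : small_pair ab ->
    measurable (survivors M (f \o cf2 ab.1 ab.2) : set (padic_borel hp)) /\
    measurable (cf2 ab.1 ab.2 @` pball 1 : set (padic_borel hp)) /\
   (mu (survivors M (f \o cf2 ab.1 ab.2)) <=
      ((p%:R ^+ s)^-1 * rho ^+ M)%:E * mu (cf2 ab.1 ab.2 @` pball 1))%E.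
  move=> [/quotient_pairP[[t ct] c1] _]; have [mH ->] := haar_scaled_image ct.
  have [mG muG] := IH _ _ (scaled_comp _ _ _ _ fs ct c1); split => //; split => //.
  by rewrite -EFinM mulrAC -invfM -exprD.
split.
  apply: countable_bigcup_measurable; first exact: small_pair_countable.
  by move=> ab /step[].
rewrite exprSr mulrA EFinM.
apply: (@le_trans _ _ (((p%:R ^+ s)^-1 * rho ^+ M)%:E * mu cylinders)%E); last first.
  by apply: lee_wpmul2l; [rewrite lee_fin|exact: haar_cylinders].
apply: le_measure_bigcup => //; first exact: small_pair_countable.
  by move=> ab /step[? []].
by move=> i j [ci _] [cj _]; exact: trivIset_cf2.
Qed.

End Survival.

Lemma finite_nat_bound (A : set nat) : finite_set A -> exists N, forall i, A i -> (i < N)%N.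
Proof.
move=> /finite_seqP[s ->]; exists (\max_(i <- s) i).+1 => i /= si.
by rewrite ltnS; exact: leq_bigmax_seq.
Qed.

(** * The algorithm as a dynamical system on pZ_p *)

Section Dynamics.
Context {p : nat} {hp : prime p}.
Local Notation Qp := (padic hp).
Implicit Types (x y z alpha : Qp) (f : Qp -> Qp).

(* [x^-1] stands for a complete quotient of odd index, so [st_rem] maps
   [alpha_2i - s alpha_2i] to [alpha_(2i+2) - s alpha_(2i+2)]. *)
Definition t_rem x : Qp := x^-1 - t_part x^-1.
Definition st_rem x : Qp := (t_rem x)^-1 - s_part (t_rem x)^-1.

Definition unstopped x := forall i, let z := iter i st_rem x in z != 0 /\ t_rem z != 0.

Context (p_odd : odd p).

Lemma st_rem_pball x : pball 1 (st_rem x).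
Proof. exact: s_partB. Qed.

(** Removing [t_rem x], an element of Z_p, does not change the negative valuation of [x^-1]. *)
Lemma hasval_t_part m x : hasval m.+1 x -> hasval (- m.+1%:Z) (t_part x^-1).
Proof.
move=> hx; have -> : t_part x^-1 = x^-1 + - t_rem x by rewrite opprB addrC subrK.
apply: (hasvalD _ 0 _ _ (hasvalV _ _ hx)); last lia.
exact/pballN/t_partB.
Qed.

Lemma st_rem_pair x : pball 1 x -> x != 0 -> t_rem x != 0 ->
  let ab := (t_part x^-1, s_part (t_rem x)^-1) in
  [/\ quotient_pair ab, x = cf2 ab.1 ab.2 (st_rem x) &
      forall k : nat, ~ pball k x -> small_pair k ab].
Proof.
move=> x1 x0 tx0 ab.
have [m hx] := pball_hasval _ _ x0 x1; rewrite (_ : 1 + m%:Z = m.+1) in hx; last lia.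
have [m' ht] := pball_hasval _ _ tx0 (t_partB p_odd x^-1); rewrite add0r in ht.
have ha := hasval_t_part _ _ hx.
have qab : quotient_pair ab.
  split; [exact: t_part_bfrac|exact: s_part_bfrac|by exists m|exists m'].
  have -> : ab.2 = (t_rem x)^-1 + - st_rem x by rewrite opprB addrC subrK.
  apply: (hasvalD _ 1 _ _ (hasvalV _ _ ht)); last lia.
  exact/pballN/st_rem_pball.
split => //; first by rewrite /cf2 /ab /= [s_part _ + _]addrC subrK invrK addrC subrK invrK.
move=> k /(hasval_notin _ _ _ hx) mk; split => //.
by apply: subset_pball (hasval_pball _ _ ha); lia.
Qed.

Lemma st_part_countable n : countable (range (@st_part p hp n)).
Proof.
rewrite /st_part; case: ifP => _.
  apply: sub_countable (@bfrac_countable p hp 0); apply: subset_card_le.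
  by move=> _ [x _ <-]; exact: t_part_bfrac.
apply: sub_countable (@bfrac_countable p hp 1); apply: subset_card_le.
by move=> _ [x _ <-]; exact: s_part_bfrac.
Qed.

(** Each step back reads alpha_n = a_n + 1 / alpha_(n+1), with only countably many possible a_n. *)
Lemma complete_quotient_countable n (A : set Qp) : countable A ->
  countable [set alpha : Qp | exists2 x, A x & complete_quotient alpha n = Some x].
Proof.
elim: n A => [|n IH] A cA /=.
  by apply: sub_countable cA; apply: subset_card_le => x [y Ay [->]].
pose B := (fun bx => bx.1 + bx.2^-1) @` (range (@st_part p hp n) `*` A).
have cB : countable B.
  apply: sub_countable (countableX (st_part_countable n) cA); exact: card_image_le.
apply: sub_countable (IH B cB); apply: subset_card_le => alpha [x Ax] /=.
case: complete_quotient => //= y; case: ifP => // _ [yx]; exists y => //.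
exists (st_part n y, x); first by split => //=; exists y.
by rewrite -yx /= invrK addrC subrK.
Qed.

(** The last complete quotient equals its own [st_part], which takes countably many values. *)
Lemma stopped_countable :
  countable [set alpha : Qp | exists n, complete_quotient alpha n = None].
Proof.
pose S n := [set alpha : Qp | exists2 x, range (st_part n) x & complete_quotient alpha n = Some x].
apply: (@sub_countable _ _ _ (\bigcup_n S n)).
  apply: subset_card_le => alpha [n]; elim: n => // n IH /=.
  case E: (complete_quotient alpha n) => [y|]; last by move=> _; exact: IH.
  by rewrite /=; case: eqP => // yE _; exists n => //; exists y => //; exists y.
by apply: bigcup_countable => // n _; apply/complete_quotient_countable/st_part_countable.
Qed.

Lemma complete_quotient_odd alpha : (forall n, complete_quotient alpha n != None) ->
  let x := alpha - s_part alpha in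
  unstopped x /\
  forall i, complete_quotient alpha (2 * i + 1)%N = Some (iter i st_rem x)^-1.
Proof.
move=> ns x.
have cS n y : complete_quotient alpha n = Some y ->
    y - st_part n y != 0 /\ complete_quotient alpha n.+1 = Some (y - st_part n y)^-1.
  by move=> yE; have := ns n.+1; rewrite /= yE /= subr_eq0; case: (y =P _).
have sE i y : st_part (2 * i).+1 y = t_part y :> Qp by rewrite /st_part /= mul2n odd_double.
have tE i y : st_part (2 * i).+2 y = s_part y :> Qp by rewrite /st_part /= mul2n odd_double.
have main i : complete_quotient alpha (2 * i).+1 = Some (iter i st_rem x)^-1 /\
    iter i st_rem x != 0.
  elim: i => [|i [IH _]]; first by have [h0 h1] := cS 0%N alpha erefl; split.
  have [_] := cS _ _ IH; rewrite sE => /cS[]; rewrite tE => h1 h2.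
  by rewrite mulnS; split.
split => i; last by rewrite addn1; exact: (main i).1.
have [IH z0] := main i; split => //.
by have [] := cS _ _ IH; rewrite sE.
Qed.

Context {k : nat}.

(** As v(a_(2i+1)) is minus the valuation of the i-th remainder, avoiding p^k Z_p means v(a_(2i+1))
    > -k. *)
Definition eventually_far N : set Qp := [set x | [/\ pball 1 x, unstopped x &
  forall i, (N <= i)%N -> ~ pball k (iter i st_rem x)]].

Lemma eventually_far_st_rem N x : eventually_far N.+1 x -> eventually_far N (st_rem x).
Proof.
move=> [_ ux fx]; split; first exact: st_rem_pball.
- by move=> i; rewrite -iterSr; exact: ux.
- by move=> i Ni; rewrite -iterSr; exact: fx.
Qed.

Lemma eventually_far0_survivors x M f : eventually_far 0 x -> survivors k M f (f x).
Proof.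
elim: M x f => [|M IH] x f fx; first by have [x1 _ _] := fx; exists x.
have [x1 /(_ 0%N)[x0 tx0] /(_ 0%N isT) nx] := fx.
have [_ xE /(_ _ nx) sab] := st_rem_pair _ x1 x0 tx0.
set ab := (_, _) in xE sab; exists ab => //; rewrite [in X in survivors _ _ _ X]xE.
apply: (IH _ (f \o cf2 ab.1 ab.2)); apply: eventually_far_st_rem.
by have [_ ux far] := fx; split => // i _; exact: far.
Qed.

Context {R : realType} {mu : {measure set (padic_borel hp) -> \bar R}}.
Context (mu_haar : normalized_haar mu).

Lemma countable_negligible (A : set Qp) : countable A ->
  mu.-negligible (A : set (padic_borel hp)).
Proof.
move=> cA; apply: (@negligibleS _ (padic_borel hp) _ mu (\bigcup_(x in A) [set x])).
  by move=> x Ax; exists x.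
apply: negligible_countable_bigcup => // x _.
have p1 : (1 : R) < p%:R by rewrite ltr1n prime_gt1.
have p0 : (0 : R) < p%:R by rewrite (lt_trans ltr01).
(* A point lies in balls around it of measure p^(-n). *)
have := @negligible_geometric _ (padic_borel hp) R mu [set x]
  (fun n : nat => cball (x : Qp) n.+1) 1 (p%:R)^-1.
apply => [|n _ ->|n|n].
- by rewrite invr_ge0 ltW //= invf_lt1.
- by rewrite /cball /= subrr; exact: pball0.
- exact: cball_measurable.
- by rewrite (haar_ball mu_haar) mul1r exprVn.
Qed.

Context (k_ge1 : (1 <= k)%N).

(** A general [f] lets the induction absorb one round into it, over countably many pairs, and lower
    [N]; at [N = 0] the image lies in the survivors of every [M]. *)
Lemma negligible_eventually_far N f s : scaled f s ->
  mu.-negligible (f @` eventually_far N : set (padic_borel hp)).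
Proof.
elim: N f s => [|N IH] f s fs.
  have hs M := haar_survivors _ mu_haar k_ge1 M _ _ fs.
  apply: (negligible_geometric mu _ (fun M => survivors k M f) _ _ (@rho_itv p hp k R)) => M.
  - by move=> _ [x fx <-]; exact: eventually_far0_survivors.
  - exact: (hs M).1.
  - exact: (hs M).2.
apply: (@negligibleS _ (padic_borel hp) _ mu (\bigcup_(ab in quotient_pair)
    ((f \o cf2 ab.1 ab.2) @` eventually_far N))).
  move=> _ [x fx <-]; have [x1 /(_ 0%N)[x0 tx0] _] := fx.
  have [qab xE _] := st_rem_pair _ x1 x0 tx0.
  exists (t_part x^-1, s_part (t_rem x)^-1) => //.
  by exists (st_rem x); [exact: eventually_far_st_rem|rewrite [in RHS]xE].
apply: negligible_countable_bigcup; first exact: quotient_pair_countable.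
by move=> ab qab; have [[t ct] c1] := quotient_pairP _ qab;
  apply: IH (scaled_comp _ _ _ _ fs ct c1).
Qed.

End Dynamics.

Theorem corollary13 (R : realType) (p : nat) (hp : prime p) (p_odd : odd p)
    (mu : {measure set (padic_borel hp) -> \bar R}) (mu_haar : normalized_haar mu)
    (k : nat) (k_ge1 : (1 <= k)%N) :
  {ae mu, forall alpha : padic hp,
    infinite_set [set i : nat |
      exists2 a, partial_quotient alpha (2 * i + 1)%N = Some a &
                 (vp a <= (- k%:Z)%:E)%E]}.
Proof.
(* [bN.1] stands for [s_part alpha], and [bN.2] for a bound on the rounds whose remainder enters p^k
   Z_p. *)
pose far bN : set (padic_borel hp) := (fun x => bN.1 + x) @` (@eventually_far p hp k bN.2).
pose stopped := [set alpha : padic hp | exists n, complete_quotient alpha n = None].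
apply: (@negligibleS _ (padic_borel hp) _ mu
  (stopped `|` \bigcup_(bN in bfrac 1 `*` setT) far bN)); last first.
  apply: negligibleU; first exact/countable_negligible/stopped_countable.
  apply: negligible_countable_bigcup.
    by apply: countableX; [exact: bfrac_countable|exact: countableP].
  by move=> bN _; apply: negligible_eventually_far => //; exact: scaled_shift.
move=> alpha /= /contrapT/finite_nat_bound[N hN].
have [|ns] := pselect (stopped alpha); [by left|right].
have [|ux qE] := complete_quotient_odd alpha.
  by move=> n; apply/eqP => sn; apply: ns; exists n.
exists (s_part alpha, N); first by split => //; exact: s_part_bfrac.
exists (alpha - s_part alpha); last by rewrite /= addrC subrK.
split => //; first exact: s_partB.
(* A remainder in p^k Z_p at round [i] would give v(a_(2i+1)) <= -k, and all such indices are below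
   [N]. *)
move=> i Ni xk; suff: (i < N)%N by rewrite ltnNge Ni.
apply: hN.
exists (t_part (iter i st_rem (alpha - s_part alpha))^-1).
  by rewrite /partial_quotient qE /= /st_part oddD oddM.
apply: vp_le => ta; have [z0 _] := ux i.
have [m hz] := pball_hasval _ _ z0 xk.
(* The predecessor fits the successor form of the lemma, as [k + m] is positive; the valuation -(k +
   m) contradicts membership in p^(1-k) Z_p. *)
have := hasval_t_part p_odd (k + m).-1; rewrite prednK; last lia.
by move=> /(_ _ _ hz) /hasval_le/(_ ta); lia.
Qed.
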